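(* Let $S_0,V_0,K>0$, and let $\eta,\sigma:(0,\infty)\to(0,\infty)$ satisfy: $\eta,\sigma$ are uniformly bounded; $\inf_{x>0}\sigma(x)>0$ and $\inf_{x>0}\eta(x)>0$; and there are constants $M,\alpha>0$ with $|\sigma(e^{x})-\sigma(e^{y})|\le M|x-y|^{\alpha}$ and $|\eta(e^{x})-\eta(e^{y})|\le M|x-y|^{\alpha}$ for all $x,y\in\mathbb{R}$. Then for every $\rho\in(-1,1)$, $$\mathcal{I}_\rho(S_0,V_0,K)\le\inf\left\{\frac12\int_0^1\left(\frac{h'(t)}{\sigma(e^{h(t)})}\right)^2dt:\ h(0)=\log V_0,\ \int_0^1e^{h(t)}\eta^2\bigl(\mathcal{F}_\rho(e^{h(t)})\bigr)dt=K\right\},$$ where the infimum is over absolutely continuous $h:[0,1]\to\mathbb{R}$ (with $\inf\emptyset=+\infty$) and $\mathcal{F}_\rho:(0,\infty)\to(0,\infty)$ is defined by $$\int_{S_0}^{\mathcal{F}_\rho(x)}\frac{dy}{y\,\eta(y)}=\int_{V_0}^{x}\frac{\rho\,dy}{\sqrt y\,\sigma(y)},\qquad x>0 .$$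
   Context: For $\rho\in(-1,1)$, $$\mathcal{I}_\rho(S_0,V_0,K)=\inf_{g,h}\left\{\frac{1}{2(1-\rho^2)}\int_0^1\left(\frac{g'(t)}{\eta(e^{g(t)})\sqrt{e^{h(t)}}}-\frac{\rho h'(t)}{\sigma(e^{h(t)})}\right)^2dt+\frac12\int_0^1\left(\frac{h'(t)}{\sigma(e^{h(t)})}\right)^2dt\right\},$$ where the infimum is over absolutely continuous $g,h:[0,1]\to\mathbb{R}$ with $g(0)=\log S_0$, $h(0)=\log V_0$ and $\int_0^1e^{h(t)}\eta^2(e^{g(t)})\,dt=K$. *)

(* Defs.v *)
From HB Require Import structures.
From mathcomp Require Import all_boot all_order all_algebra.
From mathcomp Require Import all_classical all_reals all_analysis.

Set Implicit Arguments.
Unset Strict Implicit.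
Unset Printing Implicit Defensive.

Import Order.TTheory GRing.Theory Num.Theory.
Import numFieldNormedType.Exports.

Local Open Scope classical_set_scope.
Local Open Scope ring_scope.

(* Functions on (0,oo) or on [0,1] are represented by total
   functions R -> R, of which only the values on the domain matter. *)

Definition absolutely_continuous (R : realType) (a b : R) (f : R -> R) : Prop :=
  forall e : R, 0 < e -> exists2 d : R, 0 < d &
    forall (n : nat) (u v : 'I_n -> R),
      (forall i, a <= u i /\ u i <= v i /\ v i <= b) ->
      trivIset [set: 'I_n] (fun i => `]u i, v i[%classic) ->
      \sum_(i < n) (v i - u i) < d ->
      \sum_(i < n) `|f (v i) - f (u i)| < e.

Definition oriented_integral (R : realType) (a b : R) (f : R -> R) : R :=
  if a <= b then \int[@lebesgue_measure R]_(y in `[a, b]) f y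
  else - \int[@lebesgue_measure R]_(y in `[b, a]) f y.

(* Values in the extended reals, so that a path of infinite energy costs +oo.
   Absolutely continuous functions are differentiable only almost everywhere;
   the value of the library's total derivative elsewhere (and at the endpoints,
   where it depends on the extension outside [0,1]) affects only a null set. *)
Definition vol_energy (R : realType) (sigma h : R -> R) : \bar R :=
  (\int[@lebesgue_measure R]_(t in `[0%R, 1%R])
    (((derive1 h t / sigma (expR (h t))) ^+ 2)%R%:E))%E.

Definition asset_energy (R : realType) (eta sigma : R -> R) (rho : R)
    (g h : R -> R) : \bar R :=
  (\int[@lebesgue_measure R]_(t in `[0%R, 1%R])
    (((derive1 g t / (eta (expR (g t)) * Num.sqrt (expR (h t)))
       - rho * derive1 h t / sigma (expR (h t))) ^+ 2)%R%:E))%E.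

Definition rate_function (R : realType) (eta sigma : R -> R)
    (rho S0 V0 K : R) : \bar R :=
  ereal_inf [set c : \bar R | exists g h : R -> R,
    [/\ absolutely_continuous 0 1 g /\ absolutely_continuous 0 1 h,
        g 0 = ln S0,
        h 0 = ln V0,
        (\int[@lebesgue_measure R]_(t in `[0%R, 1%R])
           ((expR (h t) * eta (expR (g t)) ^+ 2)%R%:E) = K%:E)%E &
        c = (((2 * (1 - rho ^+ 2))^-1)%R%:E * asset_energy eta sigma rho g h
             + (2^-1)%R%:E * vol_energy sigma h)%E]].

(* The positive solution z = F_rho(x) of the defining equation, for x > 0. *)
Definition F_rho (R : realType) (eta sigma : R -> R) (rho S0 V0 : R)
    (x : R) : R :=
  [get z : R | 0 < z /\
    oriented_integral S0 z (fun y => 1 / (y * eta y)) =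
    oriented_integral V0 x (fun y => rho / (Num.sqrt y * sigma y))].

(* Main.v *)
(* Given an admissible volatility path [h], take [g = ln (F_rho (exp h))].
   Differentiating the equation that defines [F_rho] gives
   [g' / (eta (e^g) sqrt (e^h)) = rho h' / sigma (e^h)], so the asset energy of
   [(g, h)] vanishes and only the volatility energy of [h] remains. *)
Require Import Defs.
From mathcomp Require Import all_boot all_order all_algebra.
From mathcomp Require Import all_classical all_reals all_analysis.
From mathcomp Require Import ring lra.
Import Order.TTheory GRing.Theory Num.Theory.
Import numFieldNormedType.Exports.
Local Open Scope classical_set_scope.
Local Open Scope ring_scope.

(** * Continuity of the coefficients on the positive half-line *)

Lemma hoelder_continuous {R : realType} (f : R -> R) (M alpha : R) :
  0 < alpha -> (forall x y, `|f x - f y| <= M * `|x - y| `^ alpha) ->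
  continuous f.
Proof.
move=> alpha0 fH x; apply/cvgrPdist_lt => e e0.
have M1 : 0 < `|M| + 1 by rewrite ltr_wpDl.
(* This [d] solves [(|M| + 1) * d^alpha = e]. Replacing [M] by [|M| + 1] makes the divisor positive
   whatever the sign of [M]. *)
pose d := (e / (`|M| + 1)) `^ alpha^-1.
have d0 : 0 < d by rewrite powR_gt0// divr_gt0.
near=> y.
apply: (le_lt_trans (fH x y)).
have xyd : `|x - y| < d.
  by near: y; exact: (@cvgr_dist_lt R R R (nbhs x) _ id x).
have {}xyd : `|x - y| `^ alpha < e / (`|M| + 1).
  have -> : e / (`|M| + 1) = d `^ alpha.
    by rewrite -powRrM mulVf ?gt_eqF// powRr1// ltW// divr_gt0.
  by apply: gt0_ltr_powR; rewrite ?nnegrE// ltW.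
have : (`|M| + 1) * `|x - y| `^ alpha < e by rewrite mulrC -ltr_pdivlMr.
apply: le_lt_trans; apply: ler_wpM2r; first exact: powR_ge0.
by rewrite (le_trans (ler_norm M))// lerDl.
Unshelve. all: by end_near. Qed.

(** The Hölder bounds are given in logarithmic coordinates. Near a positive point, [f] coincides
    with [(f \o expR) \o ln], a composite of continuous maps. *)
Lemma continuous_at_of_comp_expR {R : realType} (f : R -> R) (y : R) :
  continuous (f \o expR) -> 0 < y -> {for y, continuous f}.
Proof.
move=> cf y0.
have fy : f y = (f \o expR) (ln y) by rewrite /= lnK.
rewrite /prop_for /continuous_at fy.
apply: cvg_trans (continuous_cvg _ (cf (ln y)) (continuous_ln y0)).
apply: near_eq_cvg; near=> z.
by rewrite /= lnK// posrE; near: z; exact: lt_nbhsr.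
Unshelve. all: by end_near. Qed.

(** * Differentiating an oriented integral in its endpoint *)

Lemma is_derive_oriented_integral {R : realType} (f : R -> R) (a z : R) :
  (forall y, 0 < y -> {for y, continuous f}) -> 0 < a -> 0 < z ->
  is_derive z 1 (fun z => oriented_integral a z f) (f z).
Proof.
move=> cf a0 z0.
(* An auxiliary base point, positive and strictly below both [a] and [z]. Near [z] the oriented
   integral from [a] is the integral from [c] minus a constant, on either side of [a], so the
   fundamental theorem of calculus applies without a case split on the order of [a] and [z]. *)
pose c := Num.min a z / 2.
have m0 : 0 < Num.min a z by rewrite lt_min a0.
have c0 : 0 < c by rewrite divr_gt0.
have cm : c < Num.min a z by rewrite ltr_pdivrMr// mulr2n mulrDr mulr1 ltrDl.
move: cm; rewrite lt_min => /andP[ca cz].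
have intf (b d : R) : 0 < b ->
    (@lebesgue_measure R).-integrable `[b, d] (EFin \o f).
  move=> b0; apply: continuous_compact_integrable; first exact: segment_compact.
  apply: continuous_in_subspaceT => x; rewrite inE/= in_itv/= => /andP[bx _].
  by apply: cf; exact: lt_le_trans bx.
have chasles (x y : R) : c < x -> x <= y ->
    \int[@lebesgue_measure R]_(t in `[x, y]) f t =
    \int[@lebesgue_measure R]_(t in `[c, y]) f t -
    \int[@lebesgue_measure R]_(t in `[c, x]) f t.
  move=> cx xy; rewrite Rintegral_itvB ?bnd_simp//; last 2 first.
  - exact: intf.
  - exact: ltW.
  rewrite Rintegral_itv_obnd_cbnd//.
  apply: integrableS (intf x y (lt_trans c0 cx)) => //.
  by apply: subset_itvr; rewrite bnd_simp.
have [|dI dIE] := @continuous_FTC1_closed R f c z (z + 1) _ (intf _ _ c0) cz (cf z z0).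
  by rewrite ltrDl.
apply: (@near_eq_is_derive _ _ _
  ((fun y => \int[@lebesgue_measure R]_(t in `[c, y]) f t) -
   cst (\int[@lebesgue_measure R]_(t in `[c, a]) f t))).
  near=> y; rewrite /oriented_integral /=.
  have cy : c < y by near: y; exact: lt_nbhsr.
  have [ay|ya] := leP a y; first by rewrite (chasles _ _ ca ay).
  by rewrite (chasles _ _ cy (ltW ya)) opprB.
rewrite -[f z]subr0; apply: is_deriveB.
by rewrite -dIE derive1E; exact: derivableP.
Unshelve. all: by end_near. Qed.

Lemma oriented_integral_id {R : realType} (a : R) (f : R -> R) :
  oriented_integral a a f = 0.
Proof. by rewrite /oriented_integral lexx set_itv1 Rintegral_set1. Qed.

(** * Mean value theorem, inverse functions and the chain rule *)

Lemma MVT_everywhere {R : realType} (f df : R -> R) (x y : R) :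
  (forall z : R, is_derive z 1 f (df z)) ->
  exists z, Num.min x y <= z <= Num.max x y /\ f y - f x = df z * (y - x).
Proof.
move=> fD.
have cf : continuous f.
  by move=> z; apply/differentiable_continuous/derivable1_diffP/ex_derive.
have [xy|yx] := leP x y.
  have [|z] := @MVT_segment _ f df x y xy (fun z _ => fD z).
    exact: continuous_subspaceT.
  by rewrite in_itv/= => xzy fE; exists z.
have [|z] := @MVT_segment _ f df y x (ltW yx) (fun z _ => fD z).
  exact: continuous_subspaceT.
rewrite in_itv/= => xzy fE; exists z; split => //.
by rewrite -[LHS]opprB fE; ring.
Qed.

Lemma derive_neq0_inj {R : realType} (f df : R -> R) :
  (forall x : R, is_derive x 1 f (df x)) -> (forall x, df x != 0) -> injective f.
Proof.
move=> fD df0 x y fxy; have [z [_ /esym/eqP]] := MVT_everywhere f df x y fD.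
by rewrite fxy subrr mulf_eq0 (negbTE (df0 z))/= subr_eq0 => /eqP.
Qed.

Lemma derive_lbound_bij {R : realType} (f df : R -> R) (c : R) : 0 < c ->
  (forall x : R, is_derive x 1 f (df x)) -> (forall x, c <= df x) -> bijective f.
Proof.
move=> c0 fD cdf.
have cf : continuous f.
  by move=> z; apply/differentiable_continuous/derivable1_diffP/ex_derive.
have finj : injective f.
  by apply: (derive_neq0_inj f df) => // x; rewrite gt_eqF// (lt_le_trans c0).
have grow x y : x <= y -> c * (y - x) <= f y - f x.
  move=> xy; have [z [_ ->]] := MVT_everywhere f df x y fD.
  by rewrite ler_wpM2r// subr_ge0.
suff fsurj v : exists x, f x = v.
  exists (fun v => sval (cid (fsurj v))) => [x|v]; last by case: cid.
  by case: cid => y /= /finj.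
(* Slope at least [c] moves [f] by at least [c * r = |v - f 0|] on each side of 0, so [v] lies
   between [f (- r)] and [f r], and the intermediate value theorem gives a preimage. *)
pose r := `|v - f 0| / c.
have r0 : 0 <= r by rewrite divr_ge0// ltW.
have cr : c * r = `|v - f 0| by rewrite mulrC divfK// gt_eqF.
have := grow 0 r r0; rewrite subr0 cr => fr.
have := grow (- r) 0; rewrite oppr_le0 sub0r opprK cr => /(_ r0) fNr.
have := ler_norm (v - f 0); have := ler_norm (- (v - f 0)); rewrite normrN.
move=> vf1 vf2.
have [| | |x _ <-] := @IVT _ f (- r) r v; last by exists x.
- by rewrite (le_trans _ r0)// oppr_le0.
- exact: continuous_subspaceT.
- by rewrite ge_min le_max; apply/andP; split; apply/orP; [left|right]; lra.
Qed.

Lemma inverse_derive {R : realType} (f df g : R -> R) (x : R) :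
  (forall y : R, is_derive y 1 f (df y)) -> df x != 0 -> cancel f g ->
  is_derive (f x) 1 g (df x)^-1.
Proof.
move=> fD dfx0 fK; apply: (is_derive_inverse _ _ (fD x) dfx0).
  by near=> y; exact: fK.
near=> z; exact/differentiable_continuous/derivable1_diffP/ex_derive.
Unshelve. all: by end_near. Qed.

(* The identity also holds where [h] is not differentiable: there neither is
   [G \o h], and both derivatives take the junk value 0. *)
Lemma derive1_comp_total {R : realType} (G dG h : R -> R) (t : R) :
  (forall x : R, is_derive x 1 G (dG x)) ->
  (forall x, dG x = 0) \/ (forall x, dG x != 0) ->
  derive1 (G \o h) t = dG (h t) * derive1 h t.
Proof.
move=> GD [dG0|dG0].
  (* Here [G \o h] may be differentiable where [h] is not, but [G] is constant and both sides are
     0. *)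
  have -> : G \o h = cst (G 0).
    apply/funext => s /=; apply: is_derive_0_is_cst => x.
    by rewrite -(dG0 x).
  by rewrite derive1_cst dG0 mul0r.
have [dh|ndh] := pselect (derivable h t 1).
  have GDh := @ex_derive _ _ _ _ _ _ _ (GD (h t)).
  rewrite (derive1_comp dh GDh) (derive1E G).
  by rewrite (@derive_val _ _ _ _ _ _ _ (GD (h t))).
suff ndGh : ~ derivable (G \o h) t 1.
  have junk (k : R -> R) : ~ derivable k t 1 -> derive1 k t = 0.
    by move=> ndk; rewrite derive1E /derive dvgP.
  by rewrite !junk// mulr0.
(* [G] is injective with a differentiable left inverse, so differentiability of [G \o h] at [t]
   would pass to [h = Ginv \o (G \o h)]. *)
move=> dGh; apply: ndh.
pose Ginv v : R := [get x : R | G x = v].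
have GK : cancel G Ginv.
  move=> x; apply: (derive_neq0_inj G dG GD dG0).
  by apply: (@getPex _ [set y | G y = G x]); exists x.
have -> : h = Ginv \o (G \o h) by apply/funext => s /=; rewrite GK.
have Ginvd := inverse_derive G dG Ginv (h t) GD (dG0 _) GK.
by apply: ex_derive; apply: is_derive1_comp; exact: derivableP.
Qed.

(** * Absolutely continuous paths and their images *)

Lemma absolutely_continuous_within {R : realType} (a b : R) (h : R -> R) :
  absolutely_continuous a b h -> {within `[a, b], continuous h}.
Proof.
move=> hAC; apply/subspace_continuousP => x /=; rewrite in_itv/= => /andP[ax xb].
apply/cvgrPdist_lt => e e0.
have [d d0 hd] := hAC e e0.
(* A family consisting of a single interval turns absolute continuity into uniform continuity. *)
have close u v : a <= u -> u <= v -> v <= b -> v - u < d -> `|h v - h u| < e.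
  move=> au uv vb uvd.
  have := hd 1%N (fun=> u) (fun=> v); rewrite !big_ord1; apply => //.
  by move=> i j _ _ _; rewrite !ord1.
rewrite near_withinE; near=> y => /=; rewrite in_itv/= => /andP[ay yb].
have : `|x - y| < d by near: y; exact: (@cvgr_dist_lt R R R (nbhs x) _ id x).
have [xy|yx] := leP x y => xyd.
  rewrite distrC; apply: close => //.
  by rewrite (le_lt_trans _ xyd)// distrC ler_norm.
by apply: close => //; [exact: ltW|rewrite (le_lt_trans _ xyd)// ler_norm].
Unshelve. all: by end_near. Qed.

Lemma absolutely_continuous_bounded {R : realType} (a b : R) (h : R -> R) :
  absolutely_continuous a b h ->
  exists C, forall t, a <= t <= b -> `|h t| <= C.
Proof.
move=> /absolutely_continuous_within hc.
have [ab|ba] := leP a b; last first.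
  by exists 0 => t /andP[/le_trans /[apply]]; rewrite leNgt ba.
have [M _ hM] := EVT_max ab hc; have [m _ hm] := EVT_min ab hc.
exists (Num.max `|h M| `|h m|) => t abt.
have {}hM := hM t abt; have {}hm := hm t abt.
rewrite ler_norml le_max lerNl le_max; apply/andP; split; apply/orP.
- by right; rewrite -normrN (le_trans _ (ler_norm _))// lerN2.
- by left; rewrite (le_trans hM)// ler_norm.
Qed.

(** A Lipschitz bound on bounded sets suffices: the path is continuous on a compact interval, so it
    stays in some [[-C, C]], where [G] stretches every increment by at most [L]. *)
Lemma absolutely_continuous_comp {R : realType} (a b : R) (G h : R -> R) :
  (forall C, exists L, forall x y, `|x| <= C -> `|y| <= C ->
     `|G x - G y| <= L * `|x - y|) ->
  absolutely_continuous a b h -> absolutely_continuous a b (G \o h).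
Proof.
move=> Glip hAC e e0.
have [C hC] := absolutely_continuous_bounded a b h hAC.
have [L GL] := Glip C.
have L1 : 0 < `|L| + 1 by rewrite ltr_wpDl.
have [|d d0 hd] := hAC (e / (`|L| + 1)); first by rewrite divr_gt0.
exists d => // n u v uv uvI uvd.
have := hd n u v uv uvI uvd; rewrite ltr_pdivlMr//; apply: le_lt_trans.
rewrite mulr_suml; apply: ler_sum => i _ /=.
have [au [uvi vb]] := uv i.
rewrite (le_trans (GL _ _ (hC _ _) (hC _ _)))//.
- by rewrite (le_trans au).
- by rewrite au (le_trans uvi).
- by rewrite mulrC ler_wpM2l// (le_trans (ler_norm L))// lerDl.
Qed.

(** The mean value point lies between [x] and [y], hence again in [[-C, C]], where the derivative is
    at most [L] in absolute value. *)
Lemma locally_bounded_derive_lipschitz {R : realType} (G dG : R -> R) :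
  (forall x : R, is_derive x 1 G (dG x)) ->
  (forall C, exists L, forall x, `|x| <= C -> `|dG x| <= L) ->
  forall C, exists L, forall x y, `|x| <= C -> `|y| <= C ->
    `|G x - G y| <= L * `|x - y|.
Proof.
move=> GD dGb C; have [L dGL] := dGb C; exists L => x y xC yC.
have [z [zxy ->]] := MVT_everywhere G dG y x GD.
rewrite normrM ler_wpM2r// dGL//.
move: xC yC zxy; rewrite !ler_norml.
by have [yx|xy] := leP y x; lra.
Qed.

(** * The map [F_rho] in logarithmic coordinates *)

Lemma is_derive_oriented_integral_expR {R : realType} (f : R -> R) (a w : R) :
  (forall y, 0 < y -> {for y, continuous f}) -> 0 < a ->
  is_derive w 1 (fun u => oriented_integral a (expR u) f) (f (expR w) * expR w).
Proof.
move=> cf a0; apply: (@is_derive1_comp _ (fun z => oriented_integral a z f) expR).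
by apply: is_derive_oriented_integral => //; exact: expR_gt0.
Qed.

(* In logarithmic coordinates [F_rho] is [Ainv \o B] with
   [A u = int_S0^(e^u) dy/(y eta y)] and
   [B w = int_V0^(e^w) rho dy/(sqrt y sigma y)]. *)
Lemma F_rho_expR {R : realType} (eta sigma : R -> R) (rho S0 V0 b : R) :
  0 < S0 -> 0 < V0 ->
  (forall x, 0 < x -> 0 < eta x) -> (forall x, 0 < x -> 0 < sigma x) ->
  (forall x, 0 < x -> eta x <= b) ->
  (forall y, 0 < y -> {for y, continuous eta}) ->
  (forall y, 0 < y -> {for y, continuous sigma}) ->
  exists G : R -> R,
  [/\ forall w, F_rho eta sigma rho S0 V0 (expR w) = expR (G w),
      G (ln V0) = ln S0 &
      forall w : R, is_derive w 1 G
        (eta (expR (G w)) * (rho * Num.sqrt (expR w) / sigma (expR w)))].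
Proof.
move=> S0_gt0 V0_gt0 eta_gt0 sigma_gt0 etab ceta csigma.
pose A u := oriented_integral S0 (expR u) (fun y => 1 / (y * eta y)).
pose B w := oriented_integral V0 (expR w) (fun y => rho / (Num.sqrt y * sigma y)).
have AD (u : R) : is_derive u 1 A (eta (expR u))^-1.
  have -> : (eta (expR u))^-1 = 1 / (expR u * eta (expR u)) * expR u.
    by field; rewrite !gt_eqF ?expR_gt0//; apply: eta_gt0; exact: expR_gt0.
  apply: (is_derive_oriented_integral_expR (fun y => 1 / (y * eta y))) => // y y0.
  apply: continuousM; first exact: cst_continuous.
  apply: continuousV; first by rewrite mulf_neq0 ?gt_eqF// eta_gt0.
  by apply: continuousM; [exact: cvg_id|exact: ceta].
have BD (w : R) : is_derive w 1 B (rho * Num.sqrt (expR w) / sigma (expR w)).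
  have sw : 0 < Num.sqrt (expR w) by rewrite sqrtr_gt0 expR_gt0.
  have -> : rho * Num.sqrt (expR w) / sigma (expR w) =
      rho / (Num.sqrt (expR w) * sigma (expR w)) * expR w.
    rewrite -[X in _ = _ * X](@sqr_sqrtr _ (expR w)) ?expR_ge0//.
    by field; rewrite !gt_eqF// sigma_gt0// expR_gt0.
  apply: (is_derive_oriented_integral_expR
    (fun y => rho / (Num.sqrt y * sigma y))) => // y y0.
  apply: continuousM; first exact: cst_continuous.
  apply: continuousV; first by rewrite mulf_neq0 ?gt_eqF ?sqrtr_gt0// sigma_gt0.
  by apply: continuousM; [exact: sqrt_continuous|exact: csigma].
have b0 : 0 < b by rewrite (lt_le_trans (eta_gt0 1 _) (etab 1 _)).
(* The upper bound [b] on [eta] gives [A' = 1 / eta >= 1 / b > 0], so [A] is a bijection of the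
   whole line and the defining equation is solvable for every right-hand side. *)
have [|u|Ainv AK AinvK] := derive_lbound_bij A (fun u => (eta (expR u))^-1) b^-1 _ AD.
- by rewrite invr_gt0.
- by rewrite lef_pV2 ?posrE ?eta_gt0 ?etab ?expR_gt0.
exists (Ainv \o B); split => [w||w].
(* [F_rho] is a choice among the solutions: surjectivity of [A] shows that the choice does satisfy
   the equation, and injectivity identifies it with [expR (Ainv (B w))]. *)
- pose P z := 0 < z /\ oriented_integral S0 z (fun y => 1 / (y * eta y)) = B w.
  have [z0 zE] : P (F_rho eta sigma rho S0 V0 (expR w)).
    apply: (@getPex _ P); exists (expR (Ainv (B w))); split.
      exact: expR_gt0.
    exact: AinvK.
  rewrite -[LHS]lnK ?posrE//; congr expR; apply: (can_inj AK).
  by rewrite [RHS]AinvK /A lnK ?posrE// zE.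
(* Both integrals vanish at their base points: [B (ln V0) = 0 = A (ln S0)]. *)
- apply: (can_inj AK); rewrite /= AinvK /A /B !lnK ?posrE//.
  by rewrite !oriented_integral_id.
- apply: (@is_derive1_comp _ Ainv B).
  (* The derivative of [Ainv] at [B w] is the reciprocal of [A' = 1 / eta], taken at the preimage of
     [B w]; the double inverse puts [eta] in that form. *)
  rewrite -[B w]AinvK /= -[X in is_derive _ _ _ X]invrK.
  apply: (inverse_derive A (fun u => (eta (expR u))^-1)) => //.
  by rewrite invr_eq0 gt_eqF// eta_gt0// expR_gt0.
Qed.

(** * Comparison of the two infima *)

Theorem proposition17 (R : realType) (S0 V0 K : R) (eta sigma : R -> R)
  (S0_gt0 : 0 < S0) (V0_gt0 : 0 < V0) (K_gt0 : 0 < K)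
  (eta_gt0 : forall x : R, 0 < x -> 0 < eta x)
  (sigma_gt0 : forall x : R, 0 < x -> 0 < sigma x)
  (eta_sigma_bounded : exists B : R,
     forall x : R, 0 < x -> eta x <= B /\ sigma x <= B)
  (inf_sigma_gt0 : 0 < inf [set sigma x | x in [set x : R | 0 < x]])
  (inf_eta_gt0 : 0 < inf [set eta x | x in [set x : R | 0 < x]])
  (eta_sigma_hoelder : exists M alpha : R, 0 < M /\ 0 < alpha /\
     forall x y : R,
       `|sigma (expR x) - sigma (expR y)| <= M * (`|x - y| `^ alpha) /\
       `|eta (expR x) - eta (expR y)| <= M * (`|x - y| `^ alpha))
  (rho : R) (rho_gtN1 : -1 < rho) (rho_lt1 : rho < 1) :
  (rate_function eta sigma rho S0 V0 K <=
   ereal_inf [set c : \bar R | exists h : R -> R,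
     [/\ absolutely_continuous 0 1 h,
         h 0%R = ln V0,
         \int[@lebesgue_measure R]_(t in `[0%R, 1%R])
           ((expR (h t)
             * eta (F_rho eta sigma rho S0 V0 (expR (h t))) ^+ 2)%R%:E)
         = K%:E &
         c = (2^-1)%R%:E * vol_energy sigma h]])%E.
Proof.
have [b etasigmab] := eta_sigma_bounded.
have [M [alpha [_ [alpha0 hoelder]]]] := eta_sigma_hoelder.
have ceta y : 0 < y -> {for y, continuous eta}.
  apply: continuous_at_of_comp_expR.
  by apply: (hoelder_continuous _ M alpha) => // x z; exact: (hoelder x z).2.
have csigma y : 0 < y -> {for y, continuous sigma}.
  apply: continuous_at_of_comp_expR.
  by apply: (hoelder_continuous _ M alpha) => // x z; exact: (hoelder x z).1.
have etab x : 0 < x -> eta x <= b by move=> /etasigmab[].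
have [G [FE G0 GD]] := F_rho_expR eta sigma rho S0 V0 b
  S0_gt0 V0_gt0 eta_gt0 sigma_gt0 etab ceta csigma.
set s := inf [set sigma x | x in _] in inf_sigma_gt0.
have ssigma x : 0 < x -> s <= sigma x.
  move=> x0; apply: ge_inf; last by exists x.
  by exists 0 => _ [y y0 <-]; rewrite ltW// sigma_gt0.
have GAC h : absolutely_continuous 0 1 h -> absolutely_continuous 0 1 (G \o h).
  apply: absolutely_continuous_comp.
  apply: locally_bounded_derive_lipschitz GD _ => C.
  (* Bounds the derivative of [G] factor by factor, using [eta <= b], [expR w <= expR C] and
     [sigma >= s]. The factor [sqrt (expR w)] is why the bound depends on [C]. *)
  exists (b * (`|rho| * Num.sqrt (expR C) / s)) => w wC.
  have e0 := expR_gt0; have sw := sigma_gt0 _ (e0 R w).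
  rewrite !normrM normfV (gtr0_norm sw) (gtr0_norm (eta_gt0 _ (e0 R _))).
  rewrite (ger0_norm (sqrtr_ge0 _)).
  apply: ler_pM => //; [by rewrite ltW ?eta_gt0| | exact: etab|].
    by rewrite !mulr_ge0// invr_ge0 ltW.
  apply: ler_pM => //; [by rewrite invr_ge0 ltW| |].
    by rewrite ler_wpM2l// ler_wsqrtr// ler_expR (le_trans (ler_norm w)).
  by rewrite lef_pV2 ?posrE// ssigma.
apply: le_ereal_inf => c [h [hAC h0 hK ->]].
exists (G \o h), h; split => //.
- by split => //; exact: GAC.
- by rewrite /= h0.
- by rewrite -hK; apply: eq_integral => t _; rewrite FE.
- suff -> : asset_energy eta sigma rho (G \o h) h = 0%E by rewrite mule0 add0e.
  (* The integrand vanishes at every [t], not just almost everywhere, since the chain rule for the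
     total derivative holds at every point. *)
  apply: integral0_eq => t _; congr EFin.
  rewrite (derive1_comp_total _ _ _ _ GD).
    have e1 := eta_gt0 _ (expR_gt0 (G (h t))).
    have e2 := sigma_gt0 _ (expR_gt0 (h t)).
    have e3 : 0 < Num.sqrt (expR (h t)) by rewrite sqrtr_gt0 expR_gt0.
    by field; rewrite !gt_eqF.
  (* The dichotomy required by the chain rule: the derivative of [G] is [rho] times a positive
     factor, so it vanishes everywhere or nowhere. *)
  have [->|rho0] := eqVneq rho 0; [left|right] => x.
    by rewrite !mul0r mulr0.
  rewrite mulf_eq0 negb_or gt_eqF ?eta_gt0 ?expR_gt0//= mulf_neq0//.
    by rewrite mulf_neq0// gt_eqF ?sqrtr_gt0 ?expR_gt0.
  by rewrite invr_eq0 gt_eqF ?sigma_gt0 ?expR_gt0.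
Qed.
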